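(* Suppose $|X|=n+1$. Let $V(n)$ and $V_g(n)$ be the numbers of Lipschitz combinatorial equivalence classes of, respectively, all metrics and generic metrics on the set $X$. Then $$c_1 n^2\le \log V_g(n)\le \log V(n)\le c_2\,n^3\log(n+1)$$ for some positive absolute constants $c_1,c_2$.
   Context: Let $X$ be a finite set with $|X|=n+1$ and $\rho$ a metric on $X$. The metric $\rho$ is called strict if $\rho(x,z)<\rho(x,y)+\rho(y,z)$ for all $x,z\in X$ and $y\in X\setminus\{x,z\}$. Let $F^*$ be the $n$-dimensional space of signed measures $\mu=\sum_{x\in X}c_x\delta_x$ on $X$ with $\sum_x c_x=0$. For $x\neq y$ put $e_{x,y}=\frac{\delta_x-\delta_y}{\rho(x,y)}\in F^*$; the $n$-dimensional polytope $\mathrm{KR}(X)$ is the convex hull of all $e_{x,y}$, $x\ne y$. The metric $\rho$ is called generic if $\rho$ is strict and $\mathrm{KR}(X)$ is a simplicial polytope. For a face $\alpha$ (of arbitrary dimension) of $\mathrm{KR}(X)$, $D(\alpha)$ denotes the directed graph on the vertex set $X$ in which there is an edge from $x$ to $y$ ($x\ne y$) exactly when $e_{x,y}\in\alpha$. The collection of all directed graphs $D(\alpha)$ is called the combinatorial structure of the polytope for the metric $\rho$. Two metrics $\rho_1,\rho_2$ on the same set $X$ are Lipschitz combinatorially equivalent if their combinatorial structures coincide (as collections of directed graphs on the labelled vertex set $X$).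
   Formalization: The lower bound c_1 n^2 ≤ log V_g(n) is claimed only for n ≥ 3, since V_g(1) = V_g(2) = 1 makes it false for n = 1, 2; the other two inequalities are stated for all n ≥ 0. *)

(* Defs.v *)
From mathcomp Require Import all_boot all_order all_algebra finmap.
From mathcomp Require Import all_classical all_reals all_analysis.

Set Implicit Arguments.
Unset Strict Implicit.
Unset Printing Implicit Defensive.

Import Order.TTheory GRing.Theory Num.Theory.

Local Open Scope classical_set_scope.
Local Open Scope ring_scope.

Section Polytopes.
Variables (R : realType) (V : lmodType R).

Definition conv_hull (S : set V) : set V :=
  [set p | exists (k : nat) (v : 'I_k -> V) (c : 'I_k -> R),
    [/\ forall i, S (v i), forall i, 0 <= c i, \sum_i c i = 1
      & p = \sum_i c i *: v i]].

(* The faces include P itself (f = 0, b = 0) and the empty face (f = 0, b = 1). *)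
Definition is_face (P F : set V) : Prop :=
  exists (f : {scalar V}) (b : R),
    (forall p, P p -> f p <= b) /\ F = P `&` [set p | f p = b].

Definition affinely_independent (k : nat) (v : 'I_k -> V) : Prop :=
  forall a : 'I_k -> R,
    \sum_i a i = 0 -> \sum_i a i *: v i = 0 -> forall i, a i = 0.

(* The case k = 0 makes the empty face a simplex. *)
Definition is_simplex (F : set V) : Prop :=
  exists (k : nat) (v : 'I_k -> V),
    affinely_independent v /\ F = conv_hull (range v).

Definition simplicial (P : set V) : Prop :=
  forall F, is_face P F -> F <> P -> is_simplex F.

End Polytopes.

Section LipschitzEquivalence.
Variables (R : realType) (X : finType).
Implicit Types (rho : X -> X -> R) (M : set (X -> X -> R)).

Record is_metric rho : Prop := IsMetric {
  metric_ge0 : forall x y, 0 <= rho x y;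
  metric_eq0 : forall x y, rho x y = 0 <-> x = y;
  metric_sym : forall x y, rho x y = rho y x;
  metric_triangle : forall x y z, rho x z <= rho x y + rho y z }.

Definition strict rho : Prop :=
  forall x y z, y <> x -> y <> z -> rho x z < rho x y + rho y z.

(* A signed measure on X is the function x |-> c_x; KR rho below lies in the
   subspace of measures of total mass 0.  Every linear functional on that
   subspace extends to {ffun X -> R}, so working in the ambient space does not
   change the faces. *)
Definition delta (x : X) : {ffun X -> R} := [ffun z => (z == x)%:R].

Definition evec rho (x y : X) : {ffun X -> R} :=
  (rho x y)^-1 *: (delta x - delta y).

Definition KR rho : set {ffun X -> R} :=
  conv_hull [set p | exists x y, x <> y /\ p = evec rho x y].

Definition generic rho : Prop := strict rho /\ simplicial (KR rho).

(* A directed graph on X is given by its set of (ordered) edges. *)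
Definition face_digraph rho (alpha : set {ffun X -> R}) : set (X * X) :=
  [set xy | xy.1 <> xy.2 /\ alpha (evec rho xy.1 xy.2)].

Definition comb_structure rho : set (set (X * X)) :=
  [set face_digraph rho alpha | alpha in is_face (KR rho)].

Definition lip_equiv rho1 rho2 : Prop :=
  comb_structure rho1 = comb_structure rho2.

Definition lip_class M rho : set (X -> X -> R) :=
  [set rho' | M rho' /\ lip_equiv rho rho'].

Definition lip_classes M : set (set (X -> X -> R)) :=
  [set lip_class M rho | rho in M].

Definition metrics : set (X -> X -> R) := [set rho | is_metric rho].

Definition generic_metrics : set (X -> X -> R) :=
  [set rho | is_metric rho /\ generic rho].

(* [fset_set] is the empty set on infinite sets; this shows that this default
   value plays no role below. *)
Lemma finite_lip_classes M : finite_set (lip_classes M).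
Proof.
pose g (S : {set {set X * X}}) : set (X -> X -> R) :=
  [set rho' | M rho' /\
     comb_structure rho' = [set D | [set xy | `[< D xy >]]%SET \in S]].
apply: (@sub_finite_set _ _ (range g)); last first.
  exact/finite_image/finite_finset.
move=> _ [rho _ <-].
exists [set D : {set X * X} | `[< comb_structure rho [set` D] >]]%SET => //.
have E : comb_structure rho =
    [set D | [set xy | `[< D xy >]]%SET \in
       [set D : {set X * X} | `[< comb_structure rho [set` D] >]]%SET].
  apply/seteqP; split=> D /=; rewrite inE.
  - move=> HD; apply/asboolP.
    suff -> : [set` [set xy | `[< D xy >]]%SET] = D by [].
    by apply/seteqP; split=> xy /=; rewrite inE => /asboolP.
  - move/asboolP.
    suff -> : [set` [set xy | `[< D xy >]]%SET] = D by [].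
    by apply/seteqP; split=> xy /=; rewrite inE => /asboolP.
by rewrite /g -E; apply/seteqP; split=> rho' [Mr Er]; split.
Qed.

Definition num_classes : nat := #|` fset_set (lip_classes metrics)|.

(* This number is 1 for |X| = 2 and |X| = 3 (KR is a segment, resp. a hexagon
   with always the same cyclic order of vertices), so a lower bound c * n ^ 2 on
   its logarithm, with c > 0 and |X| = n + 1, can only hold from n = 3 on. *)
Definition num_generic_classes : nat :=
  #|` fset_set (lip_classes generic_metrics)|.

End LipschitzEquivalence.

(* Main.v *)
(* Upper bound.  A digraph D lies in the combinatorial structure of rho iff some potential
   phi satisfies phi x - phi y <= b * rho x y with equality exactly on D.  For b > 0 such a
   phi exists iff, after giving every reversed edge of D the weight - rho, each cycle has
   nonnegative weight, and positive weight when it uses an edge outside D and its reversal.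
   So the structure depends only on the signs of exp(O(n log n)) linear forms in rho, and N
   linear forms on a d-dimensional space have at most (3N + 1)^d sign patterns.

   Lower bound.  Fix points a, b and disjoint sets I, J of about n / 2 other points.  For
   G included in I x J take distances 4 on G, 7 on {a, b} and 6 elsewhere: then (x, y) is
   in G iff x -> y and a -> b lie in a common proper face.  Adding distinct powers of a
   small t to the distances makes the metric generic: a face that is not a simplex carries
   a nonzero circulation, hence makes t a root of one of finitely many nonzero polynomials. *)
Require Import Defs.
From HB Require Import structures.
From mathcomp Require Import all_boot all_order all_algebra perm finmap ring lra zify.
From mathcomp Require Import all_classical all_reals all_analysis.
Import Order.TTheory GRing.Theory Num.Theory.
Local Open Scope ring_scope.
Set Implicit Arguments. Unset Strict Implicit. Unset Printing Implicit Defensive.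
Local Open Scope classical_set_scope.

(** * Sign patterns of linear forms *)

Lemma sgr_pos_comb (R : realDomainType) (a b u v : R) :
  0 < a -> 0 < b -> Num.sg u = Num.sg v -> Num.sg (a * u + b * v) = Num.sg v.
Proof.
move=> a0 b0; case: (ltrgt0P v) => [v0|v0|->].
- rewrite (gtr0_sg v0) => /eqP; rewrite sgr_cp0 => u0.
  by apply: gtr0_sg; rewrite addr_gt0 ?mulr_gt0.
- rewrite (ltr0_sg v0) => /eqP; rewrite sgr_cp0 => u0.
  by apply: ltr0_sg; rewrite -oppr_gt0 opprD -!mulrN addr_gt0 ?mulr_gt0 ?oppr_gt0.
- by rewrite sgr0 => /eqP; rewrite sgr_eq0 => /eqP ->; rewrite !mulr0 addr0 sgr0.
Qed.

(* A sign pattern of [l] that extends to [f :: l] in several ways is also attained on the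
   kernel of [f], by convexity. *)
Lemma sign_patterns (R : realFieldType) (V : vectType R)
    (l : seq 'Hom(V, R^o)) (W : {vspace V}) :
  exists2 T : seq (seq R), (size T <= (3 * size l).+1 ^ \dim W)%N &
    forall w, w \in W -> [seq Num.sg (f w : R) | f : 'Hom(V, R^o) <- l] \in T.
Proof.
elim: l W => [|f l IH] W.
  by exists [:: [::]] => [|w _]; rewrite ?mem_seq1 // exp1n.
pose sgs w : seq R := [seq Num.sg (f w : R) | f : 'Hom(V, R^o) <- l].
have [T1 szT1 T1P] := IH W.
have [fW0|fWn0] := boolP (W <= lker f)%VS.
  exists [seq 0 :: s | s <- T1] => [|w wW].
    rewrite size_map (leq_trans szT1)//.
    by case: (\dim W) => // d; rewrite leq_exp2r //= mulnS ltnS leq_addl.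
  apply/mapP; exists (sgs w); first exact: T1P.
  by move/subvP: fW0 => /(_ _ wW); rewrite memv_ker /= => /eqP ->; rewrite sgr0.
pose H := (W :&: lker f)%VS.
have [T2 szT2 T2P] := IH H.
have dimH : (\dim H < \dim W)%N.
  by rewrite (ltn_leqif (dimv_leqif_sup (capvSl _ _))) subv_cap subvv.
(* If [f] had opposite signs at [w] and [w'], the positive combination [|f w'| w + |f w| w'] would
   lie in the kernel of [f] and carry the same pattern of [l], against the last hypothesis. *)
have sgs_f w w' : w \in W -> w' \in W -> sgs w = sgs w' ->
    (forall h, h \in H -> sgs h <> sgs w) -> Num.sg (f w : R) = Num.sg (f w' : R).
  move=> wW w'W ww' nH.
  have fn0 v : v \in W -> sgs v = sgs w -> (f v : R) != 0.
    move=> vW vw; apply/eqP => fv0; apply: (nH v) => //.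
    by rewrite memv_cap vW memv_ker; apply/eqP.
  have : 0 < (f w : R) * f w'.
    rewrite lt_neqAle eq_sym mulf_neq0 ?fn0//=.
    rewrite leNgt; apply/negP => fww'.
    have pos : 0 < `|f w' : R| /\ 0 < `|f w : R| by rewrite !normr_gt0 !fn0.
    have h0 : (`|f w' : R| * f w + `|f w : R| * f w' : R) = 0.
      case: (ltrgt0P (f w : R)) fww' => fw; [| |by rewrite fw mul0r ltxx].
        by rewrite pmulr_rlt0// => fw'; rewrite ltr0_norm//; ring.
      by rewrite nmulr_rlt0// => fw'; rewrite gtr0_norm//; ring.
    apply: (nH (`|f w' : R| *: w + `|f w : R| *: w')).
      rewrite memv_cap memvD ?memvZ//= memv_ker linearD !linearZ /=.
      exact/eqP.
    apply/eq_in_map => g gl; rewrite linearD !linearZ /=.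
    have gww' : Num.sg (g w : R) = Num.sg (g w' : R).
      have /(congr1 (fun s => nth 0 s (index g l))) := ww'.
      by rewrite !(nth_map g) ?index_mem// !nth_index.
    by rewrite gww'; case: pos => p1 p2; exact: (sgr_pos_comb p1 p2 gww').
  case: (ltrgt0P (f w : R)) => fw; last by rewrite fw mul0r ltxx.
    by rewrite pmulr_rgt0// => fw'; rewrite !gtr0_sg.
  by rewrite nmulr_rgt0// => fw'; rewrite !ltr0_sg.
(* The sign of [f] at a chosen vector with pattern [s]; unattained patterns get the default 0. *)
pose ext s := if pselect (exists2 w, w \in W & sgs w = s) is left e
  then Num.sg (f (projT1 (cid2 e)) : R) else 0.
exists ([seq ext s :: s | s <- T1] ++
        [seq e :: s | e <- [:: 0; 1; -1], s <- T2]) => [|w wW].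
  (* With N = 3 |l| + 1 and dim W = d + 1: patterns missing on [H] extend in one way, those on [H]
     in at most three, and N^(d+1) + 3 N^d <= (N+3)^(d+1). *)
  rewrite size_cat size_map size_allpairs /=.
  case: (\dim W) dimH szT1 => // d; rewrite ltnS => dimH szT1.
  set N := (3 * size l).+1 in szT1 szT2.
  have -> : (3 * (size l).+1).+1 = (N + 3)%N by rewrite /N; lia.
  have szT2' : (size T2 <= (N + 3) ^ d)%N.
    apply: (leq_trans szT2); apply: (@leq_trans (N ^ d)%N).
      by rewrite leq_pexp2l.
    by case: (d) => // d'; rewrite leq_exp2r// leq_addr.
  rewrite [X in (_ <= X)%N]expnS mulnDl leq_add ?leq_mul2l//.
  apply: (leq_trans szT1); rewrite expnS leq_mul2l.
  by case: (d) => // d'; rewrite leq_exp2r// leq_addr orbT.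
rewrite mem_cat map_cons -/(sgs w); apply/orP.
have [[h hH hw]|nH] := pselect (exists2 h, h \in H & sgs h = sgs w).
  right; apply/allpairsP; exists (Num.sg (f w : R), sgs w) => /=; split => //.
    by rewrite !inE; case: sgrP => _; rewrite eqxx ?orbT.
  by rewrite -hw T2P.
left; apply/mapP; exists (sgs w); first exact: T1P.
rewrite /ext; case: pselect => [e|[]]; last by exists w.
case: cid2 => w' w'W w'w /=; rewrite (sgs_f w w')// => h hH hw.
by apply: nH; exists h.
Qed.

(** * Potentials from nonnegative cycle weights *)

Fixpoint walk_sum (X : Type) (R : nmodType) (w : X -> X -> R) x p : R :=
  if p is y :: p' then w x y + walk_sum w y p' else 0.

Lemma walk_sum_cat (X : Type) (R : nmodType) (w : X -> X -> R) x p q :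
  walk_sum w x (p ++ q) = walk_sum w x p + walk_sum w (last x p) q.
Proof. by elim: p x => [|y p IH] x /=; rewrite ?add0r// IH addrA. Qed.

(** Links sums over a cyclic permutation to weights of closed walks, the case [y0 = y]. The end
    point [y0] is kept apart from the head [y] for the induction on [p]. *)
Lemma walk_sum_next (X : eqType) (R : nmodType) (w : X -> X -> R) y0 y p :
  uniq (y :: p) ->
  \sum_(z <- y :: p) w z (next_at z y0 y p) = walk_sum w y (rcons p y0).
Proof.
elim: p y => [|y' p IH] y; first by rewrite big_seq1 /= eqxx addr0.
rewrite [uniq _]/= => /andP[yn Up]; rewrite big_cons rcons_cons /= eqxx.
congr (_ + _); rewrite -IH// !big_seq; apply: eq_bigr => z zp.
by case: eqP zp yn => // ->->.
Qed.

(* The potential at [x] is the least weight of a simple path from [x]; permutations encode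
   the simple cycles. *)
Lemma exists_potential (R : realDomainType) (X : finType) (w : X -> X -> R) :
  (forall x, w x x = 0) -> (forall s : {perm X}, 0 <= \sum_x w x (s x)) ->
  exists phi : X -> R, forall x y, phi x - phi y <= w x y.
Proof.
move=> w0 wperm.
have cycle_ge0 x p : uniq (x :: p) -> 0 <= walk_sum w x (rcons p x).
  move=> Up; rewrite -walk_sum_next//.
  (* The cycle, extended by fixed points, is a permutation; fixed points cost nothing because [w]
     vanishes on the diagonal. *)
  have := wperm (perm (can_inj (prev_next Up))).
  rewrite (bigID (mem (x :: p))) /= [X in _ + X]big1 ?addr0 => [|z zp]; last first.
    by rewrite permE next_nth (negbTE zp) w0.
  rewrite -big_uniq//; under eq_bigr do rewrite permE; exact.
pose phi x := walk_sum w x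
  [arg min_(p < [bseq] : #|X|.-bseq X | uniq (x :: p)) walk_sum w x p]%O.
have phiP x : exists2 p, uniq (x :: p) & phi x = walk_sum w x p.
  by rewrite /phi; case: arg_minP => //= p Up _; exists p.
have phi_le x p : uniq (x :: p) -> phi x <= walk_sum w x p.
  move=> Up; have szp : (size p <= #|X|)%N.
    by have /andP[_ /card_uniqP <-] := Up; apply: max_card.
  by rewrite /phi; case: arg_minP => //= q _ /(_ (Bseq szp)); apply.
exists phi => x y; rewrite lerBlDr.
have [<-|xy] := eqVneq x y; first by rewrite w0 add0r.
have [p Up ->] := phiP y.
have [xp|xp] := boolP (x \in p); last first.
  apply: (phi_le x (y :: p)) => /=.
  by rewrite inE negb_or xy xp.
(* When the best path from [y] meets [x], prepending [x] yields a closed walk through [x], of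
   nonnegative weight, followed by the simple path [p2] from [x]. *)
case/splitPr: xp Up => p1 p2; rewrite -cat_cons cat_uniq => /and3P[U1 U12 U2].
rewrite walk_sum_cat /= !addrA; set q := _ + _ + _ + _.
have -> : q = walk_sum w x (rcons (y :: p1) x) + walk_sum w x p2.
  by rewrite /q -cats1 /= walk_sum_cat /= addr0 addrA.
apply: (le_trans (phi_le x p2 U2)); rewrite lerDr cycle_ge0//.
by rewrite cons_uniq U1 andbT; case/norP: U12.
Qed.

(** * Faces of [KR rho] as tight sets of Lipschitz potentials *)

Section Faces.
Variables (R : realType) (X : finType).
Implicit Types (rho : X -> X -> R) (phi : X -> R) (b : R).

Definition pairing phi (p : {ffun X -> R}) : R := \sum_x phi x * p x.

Lemma pairing_linear phi : scalar (pairing phi).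
Proof.
move=> a p q; rewrite /pairing mulr_sumr -big_split /=.
by apply: eq_bigr => x _; rewrite !ffunE /= mulrDr mulrCA.
Qed.

HB.instance Definition _ phi :=
  GRing.isLinear.Build R {ffun X -> R} R _ (pairing phi) (pairing_linear phi).

Lemma pairing_delta phi x : pairing phi (delta R x) = phi x.
Proof.
rewrite /pairing (bigD1 x)//= ffunE eqxx mulr1 big1 ?addr0// => y yx.
by rewrite ffunE (negbTE yx) mulr0.
Qed.

Lemma scalar_evec (f : {scalar {ffun X -> R}}) rho x y :
  f (evec rho x y) = (rho x y)^-1 * (f (delta R x) - f (delta R y)).
Proof. by rewrite /evec linearZ /= linearB. Qed.

Lemma metric_gt0 rho x y : is_metric rho -> x <> y -> 0 < rho x y.
Proof.
move=> m xy; rewrite lt_neqAle (metric_ge0 m) andbT.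
by apply/eqP => /esym /(metric_eq0 m).
Qed.

Lemma evec_KR rho x y : x <> y -> KR rho (evec rho x y).
Proof.
move=> xy; exists 1%N, (fun=> evec rho x y), (fun=> 1); split=> //.
- by move=> _; exists x, y.
- by rewrite big_ord1.
- by rewrite big_ord1 scale1r.
Qed.

Lemma scalar_conv_hull_le (f : {scalar {ffun X -> R}}) b (S : set {ffun X -> R}) :
  (forall p, S p -> f p <= b) -> forall p, conv_hull S p -> f p <= b.
Proof.
move=> fS _ [k [v [c [vS c0 c1 ->]]]]; rewrite linear_sum /=.
rewrite -[b]mul1r -c1 mulr_suml; apply: ler_sum => i _.
by rewrite linearZ /= ler_wpM2l ?fS.
Qed.

Definition slope_le rho phi b := forall x y, x <> y -> phi x - phi y <= b * rho x y.

Definition tight rho phi b : set (X * X) :=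
  [set e | e.1 <> e.2 /\ phi e.1 - phi e.2 = b * rho e.1 e.2].

Lemma KR_leP rho (f : {scalar {ffun X -> R}}) b : is_metric rho ->
  (forall p, KR rho p -> f p <= b) <-> slope_le rho (fun x => f (delta R x)) b.
Proof.
move=> m; split=> [fb x y xy|lf].
  have := fb _ (evec_KR rho xy).
  by rewrite scalar_evec mulrC ler_pdivrMr ?metric_gt0.
apply: scalar_conv_hull_le => _ [x [y [xy ->]]].
by rewrite scalar_evec mulrC ler_pdivrMr ?metric_gt0// lf.
Qed.

Lemma face_digraph_tight rho (f : {scalar {ffun X -> R}}) b : is_metric rho ->
  face_digraph rho (KR rho `&` [set p | f p = b]) =
  tight rho (fun x => f (delta R x)) b.
Proof.
move=> m; apply/seteqP; split=> -[x y] [/= xy].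
  case=> _ /=; rewrite scalar_evec => fb; split=> //=.
  by rewrite -fb mulrAC mulVf ?mul1r// gt_eqF// metric_gt0.
move=> fb; split=> //=; split; first exact: evec_KR.
by rewrite /= scalar_evec fb mulrCA mulVf ?mulr1// gt_eqF// metric_gt0.
Qed.

(** A functional enters only through its values [phi] on point masses, and [pairing] realizes every
    [phi]. As [evec] is divided by the distance, a bound [b] on the generators is a bound on the
    slopes of [phi]. *)
Lemma comb_structureP rho (D : set (X * X)) : is_metric rho ->
  comb_structure rho D <-> exists phi b, slope_le rho phi b /\ D = tight rho phi b.
Proof.
move=> m; split=> [[_ [f [b [fb ->]]] <-]|[phi [b [lphi ->]]]].
  exists (fun x => f (delta R x)), b; split; first exact/KR_leP.
  exact: face_digraph_tight.
have E : (fun x => pairing phi (delta R x)) = phi by apply/funext/pairing_delta.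
exists (KR rho `&` [set p | pairing phi p = b]); last first.
  by rewrite (face_digraph_tight (pairing phi))//= E.
by exists (pairing phi), b; split=> //; apply/(KR_leP (pairing phi)); rewrite //= E.
Qed.

(* A nonpositive bound forces phi to be constant: this is the face KR rho itself. *)
Lemma tight_le0 rho phi b : is_metric rho -> slope_le rho phi b -> b <= 0 ->
  tight rho phi b = [set e | e.1 <> e.2].
Proof.
move=> m lphi b0; apply/seteqP; split=> [e []//|[x y] /= xy]; split=> //=.
have r0 := metric_gt0 m xy; have := lphi _ _ xy; have := lphi _ _ (nesym xy).
rewrite (Defs.metric_sym m y x); have : b * rho x y <= 0 by exact: mulr_le0_ge0 b0 (ltW r0).
lra.
Qed.

Lemma tight_antisym rho phi b x y : is_metric rho -> 0 < b ->
  tight rho phi b (x, y) -> ~ tight rho phi b (y, x).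
Proof.
move=> m b0 [/= xy e1] [_ /= e2]; have := mulr_gt0 b0 (metric_gt0 m xy).
by move: e1 e2; rewrite (Defs.metric_sym m y x); lra.
Qed.

End Faces.

(** * Signs of linear forms in the metric determine the combinatorial structure *)

Section SignPatternEquivalence.
Variables (R : realType) (X : finType).
Implicit Types (rho : X -> X -> R).

(** For a permutation [s], the total weight of its cycles when the edges marked by [sigma] count
    negatively. *)
Definition signed_sum (s : X -> X) (sigma : X -> bool) rho : R :=
  \sum_x (-1) ^+ sigma x * rho x (s x).

Lemma exists_pos_lower_bound (I : finType) (P : pred I) (F : I -> R) :
  (forall i, P i -> 0 < F i) ->
  exists2 e, 0 < e & forall i, P i -> e <= F i.
Proof.
move=> F0; exists (\big[Num.min/1]_(i | P i) F i).
  by apply: lt_bigmin.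
by move=> i Pi; apply: bigmin_le_cond.
Qed.

Lemma sum_perm_sub (phi : X -> R) (s : {perm X}) : \sum_x (phi x - phi (s x)) = 0.
Proof.
rewrite sumrB [X in X - _](reindex_inj (@perm_inj _ s)).
by rewrite subrr.
Qed.

(* Requiring [e] to be tight amounts to weighting the reversed edge by [- rho e];
   lowering the weights of the remaining edges by [eps] makes them slack. *)
Lemma comb_structure_sub rho1 rho2 (D : set (X * X)) :
  is_metric rho1 -> is_metric rho2 ->
  (forall (s : {ffun X -> X}) (sigma : {ffun X -> bool}),
     Num.sg (signed_sum s sigma rho1) = Num.sg (signed_sum s sigma rho2)) ->
  comb_structure rho1 D -> comb_structure rho2 D.
Proof.
move=> m1 m2 sgE /(comb_structureP _ m1)[phi [b [lphi DE]]].
apply/(comb_structureP _ m2); have [b0|b0] := leP b 0.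
  have l0 : slope_le rho2 (fun=> 0) 0 by move=> x y _; rewrite mul0r subr0.
  by exists (fun=> 0), 0; split => //; rewrite DE (tight_le0 m1 lphi)// (tight_le0 m2 l0).
have Danti x y : D (x, y) -> ~ D (y, x) by rewrite DE; exact: tight_antisym.
have Dneq x y : D (x, y) -> x <> y by rewrite DE => -[].
pose w rho x y := (-1) ^+ `[< D (y, x) >] * rho x y.
pose good x y := [|| x == y, `[< D (x, y) >] | `[< D (y, x) >]].
(* Equality holds exactly on the edges of [D], their reversals and the loops. *)
have wphi x y : phi x - phi y <= b * w rho1 x y ?= iff good x y.
  rewrite /w /good; case: (asboolP (D (y, x))) => Dyx /=.
    have -> : phi x - phi y = b * ((-1) ^+ true * rho1 x y).
      by move: Dyx; rewrite DE expr1 (Defs.metric_sym m1 x y) => -[_ /=]; lra.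
    by rewrite !orbT; apply/leif_refl.
  rewrite orbF expr0 mul1r; have [<-|/eqP xy] := eqVneq x y.
    by rewrite (metric_eq0 m1 x x).2// mulr0 subrr; apply/leif_refl.
  split; first exact: lphi.
  apply/eqP/asboolP; rewrite DE; first by split.
  by case.
have wE rho (s : {perm X}) : \sum_x w rho x (s x) =
    signed_sum [ffun x => s x] [ffun x => `[< D (s x, x) >]] rho.
  by apply: eq_bigr => x _; rewrite !ffunE.
(* Potential differences cancel along a permutation, so its weight is nonnegative, and zero exactly
   when all its edges are good. The signs carry this over to [rho2]. *)
have sum1 (s : {perm X}) : 0 <= \sum_x w rho1 x (s x) ?= iff [forall x, good x (s x)].
  have : \sum_x (phi x - phi (s x)) <= \sum_x b * w rho1 x (s x)
      ?= iff [forall (x | true), good x (s x)].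
    by apply: leif_sum => x _; exact: wphi.
  rewrite sum_perm_sub -mulr_sumr => -[h1 h2]; split.
    by move: h1; rewrite pmulr_rge0.
  by rewrite -h2 ![0 == _]eq_sym mulf_eq0 (gt_eqF b0).
have sum2_gt0 (s : {perm X}) : ~~ [forall x, good x (s x)] -> 0 < \sum_x w rho2 x (s x).
  rewrite -sgr_gt0 wE -sgE -wE sgr_gt0 lt_neqAle => h.
  by rewrite !(sum1 s) h.
have sum2_ge0 (s : {perm X}) : 0 <= \sum_x w rho2 x (s x).
  by rewrite -sgr_ge0 wE -sgE -wE sgr_ge0 (sum1 s).
have [e e0 eP] := exists_pos_lower_bound sum2_gt0.
(* A permutation uses [#|X|] edges, so lowering each by [eps] costs less than the smallest positive
   weight bound [e]. *)
pose eps := e / #|X|.+1%:R.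
have eps0 : 0 < eps by rewrite divr_gt0.
pose v x y := w rho2 x y - (if good x y then 0 else eps).
have [x|s|psi psiP] := @exists_potential R X v.
- by rewrite /v /w /good eqxx (metric_eq0 m2 x x).2// mulr0 subrr.
- rewrite sumrB subr_ge0; have [good_s|bad_s] := boolP [forall x, good x (s x)].
    by rewrite big1// => x _; rewrite (forallP good_s).
  apply: le_trans (eP s bad_s).
  apply: (@le_trans _ _ (\sum_(x : X) eps)).
    by apply: ler_sum => x _; case: ifP => // _; exact: ltW.
  rewrite sumr_const -[_ *+ _]mulr_natr /eps mulrAC ler_pdivrMr//.
  by rewrite ler_pM2l// ler_nat.
have psi_tight x y : D (x, y) -> psi x - psi y = rho2 x y.
  move=> Dxy; have Dyx := Danti _ _ Dxy; have := psiP x y; have := psiP y x.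
  rewrite /v /w /good (asboolT Dxy) (asboolF Dyx) !orbT expr0 expr1.
  by rewrite (Defs.metric_sym m2 y x); lra.
have psi_slack x y : x <> y -> ~ D (x, y) -> psi x - psi y < rho2 x y.
  move=> xy Dxy; have := psiP x y; have := metric_gt0 m2 xy.
  rewrite /v /w /good (asboolF Dxy) (introF eqP xy) /=.
  by case: asboolP => Dyx /=; rewrite ?expr0 ?expr1; move: eps0; lra.
exists psi, 1; split=> [x y xy|].
  rewrite mul1r; have [/psi_tight -> //|/psi_slack h] := pselect (D (x, y)).
  exact/ltW/h.
apply/seteqP; split=> -[x y] /= => [Dxy|[/= xy]].
  by split; [exact: Dneq Dxy | rewrite mul1r psi_tight].
rewrite mul1r; apply: contraPP => /(psi_slack _ _ xy) h e1.
by rewrite e1 ltxx in h.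
Qed.

Lemma lip_equiv_sg rho1 rho2 : is_metric rho1 -> is_metric rho2 ->
  (forall (s : {ffun X -> X}) (sigma : {ffun X -> bool}),
     Num.sg (signed_sum s sigma rho1) = Num.sg (signed_sum s sigma rho2)) ->
  lip_equiv rho1 rho2.
Proof.
move=> m1 m2 sgE; apply/seteqP; split=> D; apply: comb_structure_sub => //.
Qed.

End SignPatternEquivalence.

(** * Comparing numbers of equivalence classes *)

Section Counting.
Variables (R : realType) (X : finType).
Implicit Types (rho : X -> X -> R) (M : set (X -> X -> R)).

Lemma lip_class_eq M rho1 rho2 : M rho1 ->
  lip_class M rho1 = lip_class M rho2 -> lip_equiv rho2 rho1.
Proof. by move=> M1 E; have : lip_class M rho1 rho1 by []; rewrite E => -[]. Qed.

Lemma lip_equiv_class M rho1 rho2 :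
  lip_equiv rho1 rho2 -> lip_class M rho1 = lip_class M rho2.
Proof. by rewrite /lip_class /lip_equiv => ->. Qed.

Lemma mem_lip_classes M rho : M rho -> lip_class M rho \in fset_set (lip_classes M).
Proof. by move=> Mr; rewrite in_fset_set ?inE; [exists rho|exact: finite_lip_classes]. Qed.

Lemma lip_class_reps M : exists s : seq (X -> X -> R),
  [/\ size s = #|` fset_set (lip_classes M)|, forall rho, rho \in s -> M rho
    & uniq s /\ {in s &, injective (lip_class M)}].
Proof.
have repr A : {rho | A \in fset_set (lip_classes M) -> M rho /\ lip_class M rho = A}.
  apply: cid; have [|nA] := boolP (A \in _); last by exists (fun _ _ => 0).
  rewrite in_fset_set ?inE; last exact: finite_lip_classes.
  by case=> rho Mr <-; exists rho.
exists [seq sval (repr A) | A <- fset_set (lip_classes M)]; split.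
- by rewrite size_map.
- by move=> _ /mapP[A AM ->]; case: (svalP (repr A) AM).
- split=> [|_ _ /mapP[A AM ->] /mapP[B BM ->]].
    apply: (@map_uniq _ _ (lip_class M)); rewrite -map_comp map_id_in ?fset_uniq//.
    by move=> A AM /=; case: (svalP (repr A) AM).
  by case: (svalP (repr A) AM) (svalP (repr B) BM) => _ -> [_ ->] ->.
Qed.

Lemma lip_classes_le (K : eqType) (T : seq K) (h : (X -> X -> R) -> K) M :
  (forall rho, M rho -> h rho \in T) ->
  (forall rho1 rho2, M rho1 -> M rho2 -> h rho1 = h rho2 -> lip_equiv rho1 rho2) ->
  (#|` fset_set (lip_classes M)| <= size T)%N.
Proof.
move=> hT hM; have [s [<- sM [Us sI]]] := lip_class_reps M.
rewrite -(size_map h); apply: uniq_leq_size.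
  rewrite map_inj_in_uniq// => r1 r2 s1 s2 h12.
  exact/sI/lip_equiv_class/hM/h12/sM/s2/sM.
by move=> _ /mapP[rho rs ->]; exact/hT/sM.
Qed.

Lemma lip_classes_ge (K : finType) (A : {set K}) (r : K -> X -> X -> R) M :
  {in A, forall k, M (r k)} -> {in A &, forall k l, lip_equiv (r k) (r l) -> k = l} ->
  (#|A| <= #|` fset_set (lip_classes M)|)%N.
Proof.
move=> rM rI; rewrite cardE -(size_map (fun k => lip_class M (r k))).
apply: uniq_leq_size.
  rewrite map_inj_in_uniq ?enum_uniq// => k l; rewrite !mem_enum => kA lA.
  by move/(lip_class_eq (rM _ kA)) => /esym; exact: rI.
move=> c /mapP[k + ->]; rewrite mem_enum => kA.
exact/mem_lip_classes/rM.
Qed.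

Lemma lip_classes_mono M1 M2 : M1 `<=` M2 ->
  (#|` fset_set (lip_classes M1)| <= #|` fset_set (lip_classes M2)|)%N.
Proof.
move=> M12; apply: (@lip_classes_le _ _ (lip_class M2)).
  by move=> rho /M12; exact: mem_lip_classes.
by move=> r1 r2 /M12 m1 _ /(lip_class_eq m1)/esym.
Qed.

End Counting.

(* For p = 0, [ln] takes the value 0. *)
Lemma ler_ln_nat (R : realType) (p q : nat) :
  (p <= q)%N -> (0 < q)%N -> ln p%:R <= ln q%:R :> R.
Proof.
case: p => [|p] pq q0; first by rewrite ln0// ln_ge0// ler1n.
by rewrite ler_ln ?posrE ?ltr0n// ler_nat.
Qed.

(** * The upper bound *)

Section UpperBound.
Variables (R : realType) (X : finType).

Definition signed_form (q : {ffun X -> X} * {ffun X -> bool})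
    (u : {ffun X * X -> R^o}) : R^o :=
  signed_sum q.1 q.2 (fun x y => u (x, y)).

Lemma signed_form_linear q : linear (signed_form q).
Proof.
move=> a u v; rewrite -[RHS]/(a * signed_form q u + signed_form q v).
rewrite /signed_form /signed_sum mulr_sumr -big_split /=.
by apply: eq_bigr => x _; rewrite !ffunE /= mulrDr mulrCA.
Qed.

HB.instance Definition _ q :=
  GRing.isLinear.Build R _ _ _ (signed_form q) (signed_form_linear q).

(** Metrics are viewed as vectors in dimension |X|^2; the base counts the pairs of a map [s] and a
    marking [sigma], that is, the signed sums. *)
Lemma num_classes_le :
  (num_classes R X <= (3 * (#|X| ^ #|X| * 2 ^ #|X|)).+1 ^ (#|X| * #|X|))%N.
Proof.
pose l := [seq linfun (signed_form q) | q <- enum {: {ffun X -> X} * {ffun X -> bool}}].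
have [T szT TP] := sign_patterns l fullv.
have szl : size l = (#|X| ^ #|X| * 2 ^ #|X|)%N.
  by rewrite size_map -cardE card_prod !card_ffun card_bool.
have dimX : \dim {: {ffun X * X -> R^o}} = (#|X| * #|X|)%N.
  by rewrite dimvf /dim /= muln1 card_prod.
rewrite szl dimX in szT; apply: leq_trans szT.
pose vec (rho : X -> X -> R) : {ffun X * X -> R^o} := [ffun e => rho e.1 e.2].
have formE q rho : linfun (signed_form q) (vec rho) = signed_sum q.1 q.2 rho.
  by rewrite lfunE; apply: eq_bigr => x _; rewrite ffunE.
apply: (@lip_classes_le _ _ _ T
  (fun rho => [seq Num.sg (f (vec rho) : R) | f : 'Hom(_, R^o) <- l])).
  by move=> rho _; apply: TP; rewrite memvf.
move=> rho1 rho2 m1 m2 E; apply: lip_equiv_sg => // s sigma.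
move: E; rewrite /l -!map_comp => /eq_in_map /(_ (s, sigma)).
by rewrite -enumT mem_enum => /(_ isT) /=; rewrite !formE.
Qed.

Lemma num_classes_card1 : #|X| = 1%N -> (num_classes R X <= 1)%N.
Proof.
move=> X1; apply: (@lip_classes_le _ _ _ [:: tt] (fun=> tt)) => // r1 r2 m1 m2 _.
suff -> : r1 = r2 by [].
apply/funext => x; apply/funext => y.
have -> : x = y by apply/fintype_le1P; rewrite X1.
by rewrite (metric_eq0 m1 y y).2// (metric_eq0 m2 y y).2.
Qed.

Lemma ln_num_classes_le n : #|X| = n.+1 ->
  ln (num_classes R X)%:R <= 24 * n%:R ^+ 3 * ln n.+1%:R :> R.
Proof.
case: n => [|n] Xn.
  (* For a single point the right-hand side is 0, so there must be at most one class. *)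
  apply: (@le_trans _ _ (ln 1%:R)); first by rewrite ler_ln_nat// num_classes_card1.
  by rewrite ln1 mulr0.
set N := n.+1; set m := N.+1 in Xn *.
have : (num_classes R X <= m ^ (24 * N ^ 3))%N.
  apply: leq_trans num_classes_le _; rewrite Xn.
  have m2 : (2 <= m)%N by [].
  (* First 3 m^m 2^m + 1 <= m^(3m) for m >= 2; then m <= 2N turns the exponent 3 m^3 into 24 N^3. *)
  apply: (@leq_trans ((m ^ (3 * m)) ^ (m * m))%N).
    rewrite leq_exp2r ?muln_gt0//.
    have -> : (3 * m = m + m + 2 + (m - 2))%N by lia.
    rewrite !expnD.
    have h1 : (2 ^ m <= m ^ m)%N by rewrite leq_exp2r.
    have h2 : (4 <= m ^ 2)%N by rewrite (@leq_exp2r 2 m 2).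
    have h3 : (0 < m ^ (m - 2))%N by rewrite expn_gt0.
    have h4 : (0 < m ^ m * 2 ^ m)%N by rewrite muln_gt0 !expn_gt0.
    apply: (@leq_trans (4 * (m ^ m * 2 ^ m))%N); first by lia.
    apply: (@leq_trans (m ^ m * m ^ m * m ^ 2)%N); last by rewrite leq_pmulr.
    by rewrite mulnC leq_mul// leq_mul.
  rewrite -expnM leq_exp2l// -mulnA.
  have -> : (m * (m * m) = m ^ 3)%N by rewrite !expnS; lia.
  rewrite (_ : 24 = 3 * 2 ^ 3)%N// -mulnA leq_mul2l -expnMn leq_exp2r//.
  by rewrite /m /N; lia.
move/(ler_ln_nat R) => /(_ _)/le_trans; apply; first by rewrite expn_gt0.
rewrite natrX lnXn ?ltr0n// -[_ *+ _]mulr_natl natrM natrX.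
exact: lexx.
Qed.

End UpperBound.

(** * Simpliciality and circulations *)

Section Simplicial.
Variables (R : realType) (X : finType).
Implicit Types (rho : X -> X -> R) (D : {set X * X}) (m : X * X -> R).

Definition circulation D m : Prop :=
  \sum_(e in D) m e *: (delta R e.1 - delta R e.2) = 0.

Definition oriented D : Prop := forall x y, (x, y) \in D -> x <> y /\ (y, x) \notin D.

Lemma circulation_potential D m (phi : X -> R) : circulation D m ->
  \sum_(e in D) m e * (phi e.1 - phi e.2) = 0.
Proof.
move=> /(congr1 (pairing phi)); rewrite linear0 linear_sum => E0; rewrite -[RHS]E0.
apply: eq_bigr => e _.
by rewrite [RHS]linearZ linearB /= !pairing_delta.
Qed.

(** If a convex combination of generators attains the maximum [b], every generator with nonzero
    coefficient attains it. Coefficients of generators with the same edge are then added up, leaving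
    one for each edge of [D]. *)
Lemma KR_face_conv_hull rho (f : {scalar {ffun X -> R}}) (b : R) (D : {set X * X}) :
  (forall p, KR rho p -> f p <= b) ->
  (forall e, (e \in D) = (e.1 != e.2) && (f (evec rho e.1 e.2) == b)) ->
  KR rho `&` [set p | f p = b] =
  conv_hull (range (fun i : 'I_#|D| => evec rho (enum_val i).1 (enum_val i).2)).
Proof.
move=> fb DE; apply/seteqP; split=> [p [[k [u [c [uE c0 c1 pE]]]] /= fp]|p].
  have /choice[E EP] i : exists e : X * X, e.1 <> e.2 /\ u i = evec rho e.1 e.2.
    by have [x [y [xy ->]]] := uE i; exists (x, y).
  have cD i : E i \notin D -> c i = 0.
    have : \sum_j c j * (b - f (u j)) = 0.
      under eq_bigr do rewrite mulrBr; rewrite sumrB -mulr_suml c1 mul1r -fp pE.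
      rewrite linear_sum; apply/eqP; rewrite subr_eq0; apply/eqP/eq_bigr => j _.
      by rewrite linearZ.
    have le_fu j : 0 <= b - f (u j).
      by rewrite subr_ge0 fb// (EP j).2; apply: evec_KR; case: (EP j).
    move/eqP; rewrite psumr_eq0 => [/allP/(_ i (mem_index_enum _))|j _]; last exact: mulr_ge0.
    rewrite /= mulf_eq0 => /orP[/eqP//|]; rewrite subr_eq0 (EP i).2 => fui.
    by rewrite DE (introF eqP (EP i).1) [_ == b]eq_sym fui.
  have splitD (V : nmodType) (g : 'I_k -> V) : (forall i, c i = 0 -> g i = 0) ->
      \sum_i g i = \sum_(j < #|D|) \sum_(i | E i == enum_val j) g i.
    move=> g0; rewrite -(big_enum_val (A := mem D) (fun e => \sum_(i | E i == e) g i)).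
    rewrite (bigID (fun i => E i \in D)) /= [X in _ + X]big1 ?addr0 => [|i /cD/g0//].
    rewrite (partition_big E (mem D))//=; apply: eq_bigr => e eD.
    by apply: eq_bigl => i; case: eqP => [->|]; rewrite ?eD ?andbF.
  exists #|D|, (fun i => evec rho (enum_val i).1 (enum_val i).2),
    (fun j => \sum_(i | E i == enum_val j) c i); split.
  - by move=> j; exists j.
  - by move=> j; apply: sumr_ge0.
  - by rewrite -splitD.
  - rewrite pE (splitD _ (fun i => c i *: u i)); last by move=> i ->; rewrite scale0r.
    apply: eq_bigr => j _; rewrite scaler_suml; apply: eq_bigr => i /eqP <-.
    by rewrite (EP i).2.
move=> [k [u [c [uE c0 c1 pE]]]].
have uD i : (exists x y, x <> y /\ u i = evec rho x y) /\ f (u i) = b.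
  have [j _ <-] := uE i; have := enum_valP j; rewrite DE => /andP[/eqP jn /eqP fj].
  by split=> //; exists (enum_val j).1, (enum_val j).2.
split; first by exists k, u, c; split=> // i; case: (uD i).
rewrite /= pE linear_sum /= -[RHS]mul1r -c1 mulr_suml.
by apply: eq_bigr => i _; rewrite linearZ /= (uD i).2.
Qed.

(** An affine dependence among the vertices of a proper face is a nonzero circulation on its edges.
    On these edges [phi] drops by [b] times the length with b > 0, and circulations annihilate
    potential differences, so every circulation there has total length zero; the hypothesis excludes
    this. *)
Lemma simplicial_KR rho : is_metric rho ->
  (forall D m, oriented D -> circulation D m -> (exists2 e, e \in D & m e != 0) ->
     exists2 m', circulation D m' & \sum_(e in D) m' e * rho e.1 e.2 != 0) ->
  simplicial (KR rho).
Proof.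
move=> mr Hrho F [f [b [fb ->]]] FP.
pose D : {set X * X} := [set e | (e.1 != e.2) && (f (evec rho e.1 e.2) == b)]%SET.
have DE e : (e \in D) = (e.1 != e.2) && (f (evec rho e.1 e.2) == b) by rewrite inE.
rewrite (KR_face_conv_hull fb DE).
exists #|D|, (fun i : 'I_#|D| => evec rho (enum_val i).1 (enum_val i).2).
split=> // a _ a0 i; apply/eqP; apply: contrapT => /negP ai.
pose phi x := f (delta R x).
have lphi : slope_le rho phi b by apply/KR_leP.
have Dt e : e \in D -> tight rho phi b e.
  by rewrite DE => /andP[/eqP en /eqP fe]; rewrite -face_digraph_tight//; split=> //=;
    split=> //; apply: evec_KR.
(* Otherwise the face would be all of [KR rho]. *)
have b0 : 0 < b.
  rewrite ltNge; apply/negP => b0; apply: FP; apply/seteqP; split=> [p []//|p Pp]; split=> //.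
  have fe x y : x <> y -> f (evec rho x y) = b.
    move=> xy; have : tight rho phi b (x, y) by rewrite (tight_le0 mr lphi b0).
    by rewrite -face_digraph_tight// => -[_ []].
  case: Pp => k [u [c [uE _ c1 ->]]]; rewrite /= linear_sum /= -[RHS]mul1r -c1 mulr_suml.
  by apply: eq_bigr => j _; rewrite linearZ /=; have [x [y [xy ->]]] := uE j; rewrite fe.
have Do : oriented D.
  move=> x y xyD; split; first by case: (Dt _ xyD).
  by apply/negP => yxD; apply: (tight_antisym mr b0 (Dt _ xyD)) (Dt _ yxD).
(* The sum only reads off the coefficient at the index of [e]; the division passes from [evec] to
   differences of point masses. *)
pose m e := (\sum_(j | enum_val j == e) a j) / rho e.1 e.2.
have mE (j : 'I_#|D|) : m (enum_val j) = a j / rho (enum_val j).1 (enum_val j).2.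
  rewrite /m (big_pred1 j)// => j'; exact: (inj_eq enum_val_inj).
have [||m' m'C] := Hrho D m Do.
- rewrite /circulation big_enum_val /= -[RHS]a0; apply: eq_bigr => j _.
  by rewrite mE /evec scalerA.
- exists (enum_val i); first exact: enum_valP.
  have ei := enum_valP i.
  by rewrite mE mulf_neq0// invr_neq0// gt_eqF// metric_gt0//; case: (Dt _ ei).
case/eqP; apply: (mulfI (lt0r_neq0 b0)); rewrite mulr0 -[RHS](circulation_potential phi m'C).
rewrite mulr_sumr; apply: eq_bigr => e /Dt[_ ->].
by rewrite mulrCA.
Qed.

End Simplicial.

(** * Generic perturbation of distances *)

Section GenericPerturbation.
Variables (R : realType) (X : finType).

Lemma exists_small_nonroot (p : {poly R}) (d : R) : p != 0 -> 0 < d ->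
  exists t, [/\ 0 < t, t < d & ~~ root p t].
Proof.
(* These [size p] distinct points of the interval exceed the degree in number. *)
move=> p0 d0; pose rs := [seq d / i.+2%:R | i <- iota 0 (size p)].
have /allPn[t /mapP[i _ ->] pt] : ~~ all (root p) rs.
  apply/negP => allr; have := max_poly_roots p0 allr.
  rewrite size_map size_iota ltnn => /(_ _)/notF; apply.
  rewrite map_inj_uniq ?iota_uniq// => i j /(mulfI (lt0r_neq0 d0))/invr_inj/eqP.
  by rewrite eqr_nat => /eqP[].
exists (d / i.+2%:R); split=> //; first by rewrite divr_gt0.
by rewrite ltr_pdivrMr// ltr_pMr// ltr1n.
Qed.

(** It depends on the unordered pair only, which keeps the perturbed distances symmetric. The
    successor keeps the exponent positive: the powers stay small and do not mix with the constant
    terms. *)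
Definition edge_index (e : X * X) : nat := (enum_rank [set e.1; e.2]%SET).+1.

Lemma edge_index_oriented (D : {set X * X}) : oriented D -> {in D &, injective edge_index}.
Proof.
move=> oD [x y] [x' y'] xyD xyD' [] /val_inj/enum_rank_inj E.
have [_ yxD] := oD _ _ xyD; have [xy' _] := oD _ _ xyD'.
have : x' \in [set x; y]%SET by rewrite E !inE eqxx.
have : y' \in [set x; y]%SET by rewrite E !inE eqxx orbT.
rewrite !inE => /orP[]/eqP yE /orP[]/eqP xE; rewrite xE yE in xyD' xy' *=> //.
by rewrite xyD' in yxD.
Qed.

(* An oriented graph supporting a nonzero circulation gives a nonzero polynomial in [t],
   because its edges carry distinct powers of [t]. *)
Lemma exists_generic_perturbation (g : X * X -> R) (d : R) : 0 < d ->
  exists t, [/\ 0 < t, t < d & forall (D : {set X * X}) (m : X * X -> R),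
    oriented D -> circulation D m -> (exists2 e, e \in D & m e != 0) ->
    exists2 m', circulation D m' & \sum_(e in D) m' e * (g e + t ^+ edge_index e) != 0].
Proof.
move=> d0; pose nontrivial (D : {set X * X}) (m : X * X -> R) := circulation D m /\ exists2 e, e \in D & m e != 0.
(* The length, as a polynomial in [t], of one circulation chosen for each [D], with default 1.
   Choosing only one leaves finitely many polynomials, so a single [t] avoids the roots of their
   product. *)
pose P (D : {set X * X}) : {poly R} := if pselect (oriented D /\ exists m, nontrivial D m) is left H
  then \sum_(e in D) projT1 (cid H.2) e *: ((g e)%:P + 'X^(edge_index e)) else 1.
have P0 D : P D != 0.
  rewrite /P; case: pselect => [[oD exm]|_]; last exact: oner_neq0.
  case: cid => m /= [_ [e eD me]]; apply/eqP => /(congr1 (fun p : {poly R} => p`_(edge_index e))).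
  rewrite coef0 coef_sum (bigD1 e)//= coefZ coefD coefC coefXn eqxx /= add0r mulr1.
  rewrite big1 ?addr0 => [/eqP|e' /andP[e'D e'e]]; first by rewrite (negbTE me).
  rewrite coefZ coefD coefC coefXn /= add0r (inj_in_eq (edge_index_oriented oD))//.
  by rewrite eq_sym (negbTE e'e) mulr0.
have [||t [t0 td rt]] := @exists_small_nonroot (\prod_(D : {set X * X}) P D) d => //.
  by apply/prodf_neq0 => D _.
exists t; split=> // D m oD mD mne.
have : ~~ root (P D) t.
  by apply: contra rt => rD; rewrite (bigD1 D)//= rootM rD.
rewrite /P; case: pselect => [[oD' exm]|[]]; last by split=> //; exists m.
case: cid => m' /= [m'C _] rt'; exists m' => //; apply: contra rt'.
rewrite rootE horner_sum => /eqP E0; apply/eqP; rewrite -[RHS]E0.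
by apply: eq_bigr => e _; rewrite !hornerE.
Qed.

End GenericPerturbation.

(** * A large family of inequivalent generic metrics *)

Section LowerBound.
Variables (R : realType) (X : finType).
Implicit Types (rho : X -> X -> R) (x y a b : X) (G : {set X * X}).

Lemma is_metric_4_8 rho : (forall x, rho x x = 0) -> (forall x y, rho x y = rho y x) ->
  (forall x y, x <> y -> 4 <= rho x y < 8) -> is_metric rho /\ strict rho.
Proof.
move=> r0 rs rb.
have rs4 x y z : y <> x -> y <> z -> rho x z < rho x y + rho y z.
  move=> /nesym/rb/andP[h1 _] /rb/andP[h2 _].
  have [xz|/eqP/rb/andP[_ h3]] := eqVneq x z; last by lra.
  by move: h1; rewrite xz r0; lra.
split=> //; split=> //.
- move=> x y; have [->|/eqP/rb] := eqVneq x y; first by rewrite r0.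
  by move=> /andP[h _]; lra.
- move=> x y; split=> [|->//]; apply: contraPP => /rb/andP[h _] E.
  by move: h; rewrite E; lra.
- move=> x y z; have [->|/eqP yx] := eqVneq y x; first by rewrite r0 add0r.
  have [->|/eqP yz] := eqVneq y z; first by rewrite r0 addr0.
  exact/ltW/rs4.
Qed.

(** An explicit potential makes both edges tight. The only other differences that can exceed 4 are
    [phi x - phi b] and [phi a - phi y], both below 23/4, hence below 6. The missing edge [(y, x)]
    certifies that the face is proper. *)
Lemma two_edges_in_face rho x y a b : is_metric rho ->
  uniq [:: x; y; a; b] -> (forall u v, u <> v -> 4 <= rho u v) ->
  rho x y < 17 / 4 -> 7 <= rho a b < 29 / 4 -> 6 <= rho x b -> 6 <= rho a y ->
  exists D, [/\ comb_structure rho D, D (x, y), D (a, b) & ~ D (y, x)].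
Proof.
move=> mr; rewrite /= !inE !negb_or => /and4P[/and3P[xy xa xb] /andP[ya yb] ab _].
move=> r4 rxy /andP[rab1 rab2] rxb ray.
pose phi u := if u == x then 3 / 2 + rho x y else if u == y then 3 / 2
  else if u == a then rho a b else if u == b then 0 else 7 / 2.
have phix : phi x = 3 / 2 + rho x y by rewrite /phi eqxx.
have phiy : phi y = 3 / 2 by rewrite /phi eq_sym (negbTE xy) eqxx.
have phia : phi a = rho a b by rewrite /phi ![a == _]eq_sym (negbTE xa) (negbTE ya) eqxx.
have phib : phi b = 0.
  by rewrite /phi ![b == _]eq_sym (negbTE xb) (negbTE yb) (negbTE ab) eqxx.
have rxy4 := r4 _ _ (elimN eqP xy).
exists (tight rho phi 1); split.
- apply/(comb_structureP _ mr); exists phi, 1; split=> // u v uv; rewrite mul1r.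
  have := r4 _ _ uv; move: uv.
  have [->|ux] := eqVneq u x; [|have [->|uy] := eqVneq u y;
    [|have [->|ua] := eqVneq u a; [|have [->|ub] := eqVneq u b]]];
  (have [->|vx] := eqVneq v x; [|have [->|vy] := eqVneq v y;
    [|have [->|va] := eqVneq v a; [|have [->|vb] := eqVneq v b]]]) => // _;
  rewrite ?phix ?phiy ?phia ?phib ?/(phi u) ?/(phi v) ?(negbTE ux) ?(negbTE uy) ?(negbTE ua)
    ?(negbTE ub) ?(negbTE vx) ?(negbTE vy) ?(negbTE va) ?(negbTE vb); lra.
- by split; [exact/eqP|rewrite /= phix phiy; lra].
- by split; [exact/eqP|rewrite /= phia phib; lra].
- by case=> _ /=; rewrite phix phiy (Defs.metric_sym mr y x); lra.
Qed.

(** Exchanging the heads of the two tight edges preserves the total drop of [phi] but shortens the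
    total length, which is impossible for c > 0. For c <= 0 the digraph is complete and contains
    [(y, x)]. *)
Lemma no_two_edges_in_face rho x y a b (D : set (X * X)) : is_metric rho ->
  x <> b -> a <> y -> rho x b + rho a y < rho x y + rho a b ->
  comb_structure rho D -> D (x, y) -> D (a, b) -> D (y, x).
Proof.
move=> mr xb ay lt4 /(comb_structureP _ mr)[phi [c [lphi ->]]] [xy /= exy] [_ /= eab].
have [c0|c0] := leP c 0; first by rewrite (tight_le0 mr lphi c0) /=; exact: nesym.
exfalso; have := lphi _ _ xb; have := lphi _ _ ay.
by move: lt4; rewrite -(ltr_pM2l c0) !mulrDr; lra.
Qed.

Variables (a b : X) (I J : {set X}).
Hypotheses (ab : a != b) (IJ : {in I, forall x, x \notin J}).
Hypotheses (aIJ : a \notin I :|: J) (bIJ : b \notin I :|: J).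

(* For x in I and y in J, these values make the sign of
   rho x y + rho a b - rho x b - rho a y tell whether (x, y) is in G. *)
Definition base_dist G (e : X * X) : R :=
  if (e \in G) || ((e.2, e.1) \in G) then 4
  else if [set e.1; e.2]%SET == [set a; b]%SET then 7 else 6.

Definition perturbed_dist G t x y : R :=
  if x == y then 0 else base_dist G (x, y) + t ^+ edge_index (x, y).

Lemma base_distC G x y : base_dist G (x, y) = base_dist G (y, x).
Proof. by rewrite /base_dist /= orbC finset.setUC. Qed.

Lemma base_dist_bounds G e : 4 <= base_dist G e <= 7.
Proof. by rewrite /base_dist; case: ifP => _; [|case: ifP => _]; lra. Qed.

Section SmallPerturbation.
Variables (G : {set X * X}) (t : R).
Hypotheses (GIJ : G \subset finset.setX I J) (t0 : 0 < t) (t1 : t < 1 / 4).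

Lemma perturbed_dist_bounds x y : x <> y ->
  base_dist G (x, y) < perturbed_dist G t x y < base_dist G (x, y) + 1 / 4.
Proof.
move=> xy; rewrite /perturbed_dist (introF eqP xy) ltrDl exprn_gt0//= ltrD2l.
apply: le_lt_trans t1; rewrite /edge_index exprS.
have t0' := ltW t0; have t1' : t <= 1 by move: t1; lra.
by rewrite ler_piMr// exprn_ile1.
Qed.

Lemma perturbed_dist_metric :
  is_metric (perturbed_dist G t) /\ strict (perturbed_dist G t).
Proof.
apply: is_metric_4_8 => [x|x y|x y xy]; first by rewrite /perturbed_dist eqxx.
  by rewrite /perturbed_dist eq_sym base_distC /edge_index /= finset.setUC.
by have := perturbed_dist_bounds xy; have := base_dist_bounds G (x, y); lra.
Qed.

Lemma edge_in_G x y u : (x, y) \in G -> u \notin I :|: J ->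
  [/\ x != u, y != u, x != y, x \in I & y \in J].
Proof.
move/(fintype.subsetP GIJ); rewrite finset.in_setX inE /= => /andP[xI yJ] /norP[uI uJ]; split=> //.
- by apply: contra uI => /eqP <-.
- by apply: contra uJ => /eqP <-.
- by apply: contraTneq xI => ->; apply: contraL yJ => /IJ.
Qed.

Lemma base_dist_out x y : x \notin I :|: J \/ y \notin I :|: J ->
  base_dist G (x, y) = if [set x; y]%SET == [set a; b]%SET then 7 else 6.
Proof.
move=> h; rewrite /base_dist /=; case: ifP => // /orP[] xyG.
all: by case: h => /(edge_in_G xyG)[]; rewrite eqxx.
Qed.

Lemma base_dist_ab : base_dist G (a, b) = 7.
Proof. by rewrite base_dist_out ?eqxx//; left. Qed.

Lemma base_dist_6 x y : x \in I -> y \in J -> (x, y) \notin G ->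
  base_dist G (x, y) = 6.
Proof.
move=> xI yJ xyG; rewrite /base_dist /= (negbTE xyG) /=; case: ifP => [yxG|_].
  by have [_ _ _ yI _] := edge_in_G yxG aIJ; rewrite (negbTE (IJ yI)) in yJ.
case: eqP => // /setP/(_ x); rewrite !inE eqxx => /esym/orP[]/eqP xE.
  by move: aIJ; rewrite -xE inE xI.
by move: bIJ; rewrite -xE inE xI.
Qed.

Lemma base_dist_6_out x y : x \in I -> y \in J ->
  base_dist G (x, b) = 6 /\ base_dist G (a, y) = 6.
Proof.
move=> xI yJ; rewrite !base_dist_out; [|by left|by right]; split; case: eqP => // /setP.
  move/(_ x); rewrite !inE eqxx => /esym/orP[]/eqP xE.
    by move: aIJ; rewrite -xE inE xI.
  by move: bIJ; rewrite -xE inE xI.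
move/(_ y); rewrite !inE eqxx orbT => /esym/orP[]/eqP yE.
  by move: aIJ; rewrite -yE inE yJ orbT.
by move: bIJ; rewrite -yE inE yJ orbT.
Qed.

End SmallPerturbation.

Lemma perturbed_dist_inj (G H : {set X * X}) (t s : R) :
  G \subset finset.setX I J -> H \subset finset.setX I J ->
  0 < t -> t < 1 / 4 -> 0 < s -> s < 1 / 4 ->
  lip_equiv (perturbed_dist G t) (perturbed_dist H s) -> G \subset H.
Proof.
move=> GIJ HIJ t0 t1 s0 s1 E; apply/fintype.subsetP => -[x y] xyG.
have [xa ya xy xI yJ] := edge_in_G GIJ xyG aIJ; have [xb yb _ _ _] := edge_in_G GIJ xyG bIJ.
have [mG _] := perturbed_dist_metric G t0 t1; have [mH _] := perturbed_dist_metric H s0 s1.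
have bndG u v (uv : u != v) := perturbed_dist_bounds G t0 t1 (elimN eqP uv).
have bndH u v (uv : u != v) := perturbed_dist_bounds H s0 s1 (elimN eqP uv).
have ay : a != y by rewrite eq_sym.
have [|u v /eqP uv|||||D [DG Dxy Dab nDyx]] := @two_edges_in_face _ x y a b mG.
- by rewrite /= !inE !negb_or xy xa xb ya yb ab.
- by have := bndG u v uv; have := base_dist_bounds G (u, v); lra.
- have := bndG x y xy; rewrite /base_dist xyG /=; lra.
- have := bndG a b ab; rewrite base_dist_ab//; lra.
- have := bndG x b xb; rewrite (base_dist_6_out GIJ xI yJ).1; lra.
- have := bndG a y ay; rewrite (base_dist_6_out GIJ xI yJ).2; lra.
apply: contrapT => /negP xyH; apply: nDyx.
(* For [H] the crossed pairs sum to less than 6 + 6 + 1/2, the direct ones to more than 6 + 7. *)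
apply: (@no_two_edges_in_face _ x y a b D mH (elimN eqP xb) (elimN eqP ay)) => //.
  have := bndH x b xb; have := bndH a y ay; have := bndH x y xy; have := bndH a b ab.
  rewrite base_dist_ab// (base_dist_6 HIJ xI yJ xyH).
  by rewrite (base_dist_6_out HIJ xI yJ).1 (base_dist_6_out HIJ xI yJ).2; lra.
by rewrite -E.
Qed.

Lemma num_generic_classes_ge : (2 ^ (#|I| * #|J|) <= num_generic_classes R X)%N.
Proof.
rewrite -cardsX -card_powerset.
have quarter : 0 < 1 / 4 :> R by lra.
have /choice[t tP] G := exists_generic_perturbation (base_dist G) quarter.
apply: (@lip_classes_ge _ _ _ _ (fun G => perturbed_dist G (t G))).
  move=> G _; have [t0 t1 tG] := tP G.
  have [mG sG] := perturbed_dist_metric G t0 t1; split=> //; split=> //.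
  apply: simplicial_KR => // D m oD mC mne; have [m' m'C m'0] := tG D m oD mC mne.
  exists m' => //; move: m'0; congr (_ != _); apply: eq_bigr => -[x y] xyD.
  by rewrite /perturbed_dist /= (introF eqP (oD x y xyD).1).
move=> G H; rewrite !inE => GIJ HIJ E.
have [t0 t1 _] := tP G; have [s0 s1 _] := tP H.
by apply/eqP; rewrite finset.eqEsubset (perturbed_dist_inj _ _ t0 t1 s0 s1 E)//
  (perturbed_dist_inj _ _ s0 s1 t0 t1 (esym E)).
Qed.

End LowerBound.

(** * Choice of the points and of the constants *)

Lemma exists_grid (X : finType) m : (2 * m + 2 <= #|X|)%N ->
  exists a b (I J : {set X}), [/\ a != b, {in I, forall x, x \notin J},
    a \notin I :|: J, b \notin I :|: J & #|I| = m /\ #|J| = m].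
Proof.
rewrite cardE; case: (enum X) (enum_uniq X) => [|a [|b s]]; rewrite ?addn2//.
rewrite [uniq _]/= inE negb_or -andbA => /and4P[ab as' bs Us]; rewrite /= !ltnS => szs.
pose r := drop m s; have Ur : uniq r by rewrite drop_uniq.
have sub_take u : u \in take m s -> u \in s by move=> /mem_take.
have sub_take' u : u \in take m r -> u \in s by move=> /mem_take/mem_drop.
exists a, b, [set u in take m s]%SET, [set u in take m r]%SET; split=> //.
- move=> u; rewrite !inE => h1; apply/negP => /mem_take h2.
  by move: Us; rewrite -(cat_take_drop m s) cat_uniq => /and3P[_ /hasPn/(_ _ h2)/negP].
- by rewrite !inE; apply/negP => /orP[/sub_take|/sub_take'] h; rewrite h in as'.
- by rewrite !inE; apply/negP => /orP[/sub_take|/sub_take'] h; rewrite h in bs.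
- rewrite !cardsE !(card_uniqP _) ?take_uniq// !size_take_min size_drop.
  by split; apply/minn_idPl; lia.
Qed.

Lemma num_classes_gt0 (R : realType) (X : finType) : (0 < num_classes R X)%N.
Proof.
pose rho x y : R := (x != y :> X)%:R.
suff /mem_lip_classes h : metrics rho.
  by rewrite /num_classes cardfs_gt0; apply/fset0Pn; exists (lip_class (@metrics R X) rho).
split.
- by move=> x y; rewrite ler0n.
- by move=> x y; rewrite /rho; case: eqVneq => [->|/eqP xy] /=; split=> // /eqP; rewrite oner_eq0.
- by move=> x y; rewrite /rho eq_sym.
- move=> x y z; rewrite /rho -natrD ler_nat.
  by case: (eqVneq x y) => [->|_]; rewrite ?add0n// (leq_trans (leq_b1 _)).
Qed.

Theorem theorem2 (R : realType) :
  exists c1 c2 : R,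
    [/\ 0 < c1, 0 < c2 &
      forall (n : nat) (X : finType), #|X| = n.+1 ->
        [/\ (3 <= n)%N -> c1 * n%:R ^+ 2 <= ln (num_generic_classes R X)%:R,
            ln (num_generic_classes R X)%:R <= ln (num_classes R X)%:R :> R &
            ln (num_classes R X)%:R <= c2 * n%:R ^+ 3 * ln n.+1%:R]].
Proof.
have ln2_gt0 : 0 < ln 2 :> R by rewrite ln_gt0// ltr1n.
exists (ln 2 / 16), 24; split=> //; first by rewrite divr_gt0.
move=> n X Xn; split.
(* Two points and two blocks of size [m] fit into n + 1 points, and n <= 4m for n >= 3; hence m^2 >=
   n^2 / 16, which explains the constant [ln 2 / 16]. *)
- move=> n3; pose m := (n.-1)./2.
  have [|a [b [I [J [ab IJ aIJ bIJ [Im Jm]]]]]] := @exists_grid X m.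
    by rewrite Xn /m; lia.
  have := num_generic_classes_ge R ab IJ aIJ bIJ; rewrite Im Jm => hV.
  apply: le_trans (ler_ln_nat R hV (leq_trans _ hV)); last by rewrite expn_gt0.
  rewrite natrX lnXn ?ltr0n// -[leRHS]mulr_natr natrM -mulrA ler_pM2l//.
  have nm : n%:R <= 4 * m%:R :> R by rewrite -natrM ler_nat /m; lia.
  have := ler0n R n; nra.
- apply: ler_ln_nat; last exact: num_classes_gt0.
  by apply: lip_classes_mono => rho [].
- exact: ln_num_classes_le.
Qed.
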